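(* Let $R$ be a connected $r$-regular graph of order $q$ and diameter at most two. Let $G=G(T,R,p)$ be a loaded tree of $k\ge2$ copies of $R$. Suppose that the maximum port load is exactly $L$ and that every copy $R_i$ contains an unused selector. Then $G$ is connected and \[ |V(G)|=qk,\qquad |E(G)|=\frac{rqk}{2}+k-1,\qquad \Delta(G)=r+L, \] \[ \rho(G)=k,\qquad \tau_D(G)=(q-1)k . \] Moreover, \[ \mu(G)=k\bigl((r+L)^2+3-(L+1)q\bigr)-2, \] and hence \[ \tau_D(G)-\mathsf{B}_{\mathrm{HY}}(G)=\frac{k\bigl((L+1)q-(r+L)^2-3\bigr)+2}{(r+L)^2+1}. \]
   Context: All graphs are finite, simple and undirected. For a graph $G$ write $n=|V(G)|$, $m=|E(G)|$, and $\Delta=\Delta(G)$ for the maximum degree. A set $S\subseteq V(G)$ is an identifying vertex cover if $e\cap S\neq\emptyset$ for every $e\in E(G)$ and the sets $e\cap S$ ($e\in E(G)$) are pairwise distinct; $\tau_D(G)$ is the minimum cardinality of an identifying vertex cover. A packing is a set of vertices whose distinct members are at pairwise distance at least three (vertices in different components have distance $+\infty$); $\rho(G)$ is the maximum cardinality of a packing. Define \[ \mathsf{B}_{\mathrm{HY}}(G)=\frac{\Delta(\Delta-1)n+2m}{\Delta^2+1},\qquad \mu(G)=\Delta(\Delta-1)n+2m-(\Delta^2+1)\tau_D(G). \] Loaded tree of fibres: let $T$ be a tree on the vertex set $[k]=\{1,\dots,k\}$, $k\ge2$, and let $R_1,\dots,R_k$ be vertex-disjoint copies of a graph $R$. For every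 incidence $(i,e)$ with $i\in e\in E(T)$, choose a vertex $p_{i,e}\in V(R_i)$, called its port (different incidences at the same $i$ may use the same or different ports). The load of $v\in V(R_i)$ is $\lambda_i(v)=|\{e\in E(T): i\in e \text{ and } p_{i,e}=v\}|$. The maximum port load is $\max_{i,v}\lambda_i(v)$. A vertex $s_i\in V(R_i)$ with $\lambda_i(s_i)=0$ is an unused selector. The graph $G(T,R,p)$ is obtained from the disjoint union of $R_1,\dots,R_k$ by adding, for every edge $e=ij$ of $T$, the edge $p_{i,e}p_{j,e}$. *)

(* Defs.v *)
From HB Require Import structures.
From mathcomp Require Import all_boot all_order all_algebra.
Set Implicit Arguments.
Unset Strict Implicit.
Unset Printing Implicit Defensive.
Import Order.TTheory GRing.Theory Num.Theory.

Record sgraph (V : finType) := SGraph {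
  adj :> rel V;
  adj_sym : symmetric adj;
  adj_irr : irreflexive adj }.

Definition nverts (V : finType) (G : sgraph V) : nat := #|V|.

Section Graphs.
Variables (V : finType) (G : sgraph V).

Definition edges : {set {set V}} :=
  [set e | [exists x, exists y, G x y && (e == [set x; y])]].

Definition nedges : nat := #|edges|.

Definition deg (v : V) : nat := #|[set w | G v w]|.

Definition max_deg : nat := \max_(v : V) deg v.

Definition regular (r : nat) : Prop := forall v, deg v = r.

Definition connected : Prop := 0 < nverts G /\ forall x y, connect G x y.

Definition acyclic : Prop := forall c : seq V, 2 < size c -> ~ ucycle G c.

Definition is_tree : Prop := connected /\ acyclic.

Definition walk (n : nat) (x y : V) : bool :=
  [exists w : n.-tuple V, path G x w && (last x w == y)].

(* None stands for +oo. Only lengths below #|V| need be searched, because a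
   shortest walk has no repeated vertex. *)
Definition dist (x y : V) : option nat :=
  let d := find (fun n => walk n x y) (iota 0 #|V|) in
  if d < #|V| then Some d else None.

Definition diam_le (n : nat) : Prop :=
  forall x y, if dist x y is Some d then d <= n else false.

Definition packing (S : {set V}) : bool :=
  [forall x in S, forall y in S,
     (x != y) ==> (if dist x y is Some d then 3 <= d else true)].

Definition rho : nat := \max_(S : {set V} | packing S) #|S|.

Definition identifying_vertex_cover (S : {set V}) : bool :=
  [forall e in edges, e :&: S != set0] &&
  [forall e in edges, forall f in edges, (e != f) ==> (e :&: S != f :&: S)].

(* The default setT is itself an identifying vertex cover
   (see setT_identifying), so this is a genuine minimum. *)
Definition tau_D : nat :=
  #|[arg min_(S < [set: V] | identifying_vertex_cover S) #|S|]|.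

Lemma setT_identifying : identifying_vertex_cover [set: V].
Proof.
apply/andP; split; apply/forall_inP => e.
  rewrite inE setIT => /existsP[x /existsP[y /andP[_ /eqP->]]].
  by apply/set0Pn; exists x; rewrite !inE eqxx.
by move=> _; apply/forall_inP => f _; rewrite !setIT; apply/implyP.
Qed.

Local Open Scope ring_scope.

Definition B_HY : rat :=
  let D : rat := max_deg%:R in
  (D * (D - 1) * (nverts G)%:R + 2 * nedges%:R) / (D ^+ 2 + 1).

Definition mu : int :=
  let D : int := max_deg%:Z in
  D * (D - 1) * (nverts G)%:Z + 2 * nedges%:Z - (D ^+ 2 + 1) * tau_D%:Z.

End Graphs.

Section LoadedTree.
Variables (k : nat) (T : sgraph 'I_k) (V : finType) (R : sgraph V).

(* p i e is the port of the incidence (i, e), as a vertex of R; the copy R_i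
   has vertices (i, v). Only the values with i \in e and e \in edges T are
   ever used. *)
Variable p : 'I_k -> {set 'I_k} -> V.

Definition load (i : 'I_k) (v : V) : nat :=
  #|[set e in edges T | (i \in e) && (p i e == v)]|.

Definition max_load : nat := \max_(i < k) \max_(v : V) load i v.

Definition loaded_tree_adj : rel ('I_k * V) := fun x y =>
  (x.1 == y.1) && R x.2 y.2 ||
  [&& T x.1 y.1, x.2 == p x.1 [set x.1; y.1] & y.2 == p y.1 [set x.1; y.1]].

Lemma loaded_tree_sym : symmetric loaded_tree_adj.
Proof.
move=> [i a] [j b]; rewrite /loaded_tree_adj /= eq_sym (adj_sym R).
by rewrite (adj_sym T) setUC [X in _ || (_ && X)]andbC.
Qed.

Lemma loaded_tree_irr : irreflexive loaded_tree_adj.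
Proof. by move=> [i a]; rewrite /loaded_tree_adj /= !adj_irr andbF. Qed.

Definition loaded_tree : sgraph ('I_k * V)%type :=
  SGraph loaded_tree_sym loaded_tree_irr.

End LoadedTree.

(* Main.v *)
(* A set is an identifying vertex cover exactly when its complement is a packing,
   so tau_D = n - rho.  In the loaded tree a packing meets each copy of R at most
   once because R has diameter at most two, while one unused selector per copy
   gives a packing, since all neighbours of a selector lie in its own copy; hence
   rho = k.  The remaining quantities come from the degree formula
   deg (i, v) = deg v + load i v, the handshake lemma, and the k - 1 edges of T. *)

Require Import Defs.
From HB Require Import structures.
From mathcomp Require Import all_boot all_order all_algebra.
From mathcomp Require Import ring.
Set Implicit Arguments.
Unset Strict Implicit.
Unset Printing Implicit Defensive.
Import Order.TTheory GRing.Theory Num.Theory.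
Local Open Scope ring_scope.

(** * Edges, distances, packings and identifying vertex covers of a graph *)

Section Graphs.
Variables (V : finType) (G : sgraph V).
Implicit Types (x y z v w : V) (S : {set V}) (e f : {set V}).
Local Open Scope nat_scope.

Lemma adj_neq x y : G x y -> x != y.
Proof. by apply: contraTneq => ->; rewrite adj_irr. Qed.

Lemma edgesP e :
  reflect (exists x y, G x y /\ e = [set x; y]) (e \in edges G).
Proof.
rewrite inE; apply: (iffP existsP) => [[x /existsP[y /andP[Gxy /eqP->]]]|].
  by exists x, y.
by case=> x [y [Gxy ->]]; exists x; apply/existsP; exists y; rewrite Gxy eqxx.
Qed.

Lemma edge_set2 x y : ([set x; y] \in edges G) = G x y.
Proof.
apply/edgesP/idP => [[a [b [Gab Exy]]]|Gxy]; last by exists x, y.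
have /set2P ax : a \in [set x; y] by rewrite Exy set21.
have /set2P bx : b \in [set x; y] by rewrite Exy set22.
case: ax bx Gab => -> [] ->; rewrite ?adj_irr //.
by rewrite adj_sym.
Qed.

Lemma set2_injr x : injective (fun y => [set x; y]).
Proof.
move=> y z Eyz.
have /set2P[yx|//] : y \in [set x; z] by rewrite -Eyz set22.
have /set2P[zx|//] : z \in [set x; y] by rewrite Eyz set22.
by rewrite yx zx.
Qed.

(** An edge at [x] is determined by its other endpoint. The predicate [P] is left free so that both
    degrees ([predT]) and loads (a port condition) are instances. *)
Lemma edges_incident x (P : pred {set V}) :
  #|[set e in edges G | (x \in e) && P e]| =
  #|[set y | G x y && P [set x; y]]|.
Proof.
rewrite -(card_imset _ (@set2_injr x)); apply: eq_card => e.
rewrite inE; apply/andP/imsetP.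
  move=> [/edgesP[a [b [Gab ->]]]] /andP[/set2P[] -> Pab].
    by exists b; rewrite // inE Gab.
  by exists a; last exact: setUC; rewrite inE adj_sym Gab setUC.
case=> y; rewrite inE => /andP[Gxy Pxy] ->.
by rewrite edge_set2 set21.
Qed.

Lemma deg_edges x : deg G x = #|[set e in edges G | x \in e]|.
Proof.
transitivity #|[set e in edges G | (x \in e) && predT e]|.
  by rewrite edges_incident; apply: eq_card => y; rewrite !inE andbT.
by apply: eq_card => e; rewrite !inE andbT.
Qed.

(** Double counting of incidences: after exchanging the sums, each edge contributes its cardinality,
    which is two. *)
Lemma handshake : \sum_v deg G v = 2 * nedges G.
Proof.
under eq_bigr => v _ do rewrite deg_edges -sum1dep_card big_mkcond /=.
rewrite exchange_big /= mulnC -sum_nat_const big_mkcond [RHS]big_mkcond /=.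
apply: eq_bigr => e _; rewrite -big_mkcond /=.
case: ifPn => [Ge|nGe]; last by rewrite big_pred0.
transitivity #|e|; last first.
  by case/edgesP: Ge => x [y [Gxy ->]]; rewrite cards2 adj_neq.
exact: sum1_card.
Qed.

Lemma walkP n x y :
  reflect (exists s, [/\ path G x s, last x s = y & size s = n])
          (walk G n x y).
Proof.
apply: (iffP existsP) => [[s /andP[Gs /eqP]]|[s [Gs sy /eqP sz]]].
  by exists s; rewrite size_tuple.
by exists (Tuple sz); rewrite /= Gs sy eqxx.
Qed.

(* Shortening a walk shows that the cut-off of the search at [#|V|] loses
   nothing. *)
Lemma dist_leP n x y :
  reflect (exists s, [/\ path G x s, last x s = y & size s <= n])
          (if dist G x y is Some d then d <= n else false).
Proof.
pose P m := walk G m x y; rewrite /dist -/P; set d := find P _.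
have dP m : m < #|V| -> walk G m x y -> d <= m.
  move=> mV Pm; rewrite leqNgt; apply/negP => /(before_find 0).
  by rewrite nth_iota // /P Pm.
apply: (iffP idP) => [|[s [Gs sy sn]]].
  case: ifP => // dV dn; have: has P (iota 0 #|V|) by rewrite has_find size_iota.
  move/(nth_find 0); rewrite nth_iota // => /walkP[s [? ? sz]].
  by exists s; rewrite sz.
case/shortenP: Gs sy => s' Gs' Us' s's sy.
have s'V : size s' < #|V| by rewrite -[_ < _]/(size (x :: s') <= _) -(card_uniqP Us') max_card.
have s'n : size s' <= n.
  by apply: leq_trans sn; apply: uniq_leq_size => //; case/andP: Us'.
have ds' : d <= size s' by apply: dP => //; apply/walkP; exists s'.
by rewrite (leq_ltn_trans ds' s'V) (leq_trans ds').
Qed.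

(** The diameter bound and the packing condition both turn on the threshold two; here it becomes a
    statement about adjacency alone, free of the search in [dist]. *)
Lemma dist_le2 x y :
  (if dist G x y is Some d then d <= 2 else false) =
  [|| x == y, G x y | [exists z, G x z && G z y]].
Proof.
apply/dist_leP/or3P => [[[|a [|b [|c s]]] [/= Gs sy //]]|].
- by move=> _; constructor 1; apply/eqP.
- by move=> _; constructor 2; rewrite -sy; case/andP: Gs.
- move=> _; constructor 3; apply/existsP; exists a.
  by case/and3P: Gs => -> Gab _; rewrite -sy Gab.
case=> [/eqP->|Gxy|/existsP[z /andP[Gxz Gzy]]].
- by exists [::].
- by exists [:: y]; rewrite /= Gxy.
- by exists [:: z; y]; rewrite /= Gxz Gzy.
Qed.

Lemma packingP S :
  reflect {in S &, forall x y, x != y ->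
             ~~ G x y /\ forall z, ~~ (G x z && G z y)}
          (packing G S).
Proof.
have far x y : (if dist G x y is Some d then 3 <= d else true) =
    ~~ [|| x == y, G x y | [exists z, G x z && G z y]].
  by rewrite -dist_le2; case: dist => // d; rewrite -ltnNge.
apply: (iffP forall_inP) => [pS x y xS yS xy|pS x xS].
  move/forall_inP/(_ y yS): (pS x xS); rewrite xy far /= !negb_or.
  by case/and3P=> _ ? /existsPn.
apply/forall_inP => y yS; apply/implyP => xy; rewrite far !negb_or xy.
by case: (pS x y xS yS xy) => -> /= ?; apply/existsPn.
Qed.

(* Two edges with the same trace on [~: S] either lie inside [S] or are [xu]
   and [xw] with [u], [w] in [S], i.e. at distance two. *)
Lemma identifying_setC S : identifying_vertex_cover G (~: S) = packing G S.
Proof.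
apply/andP/packingP => [[/forall_inP cS /forall_inP iS] x y xS yS xy|pS].
  split=> [|z]; apply/negP.
    move=> Gxy; have := cS [set x; y]; rewrite edge_set2 => /(_ Gxy)/set0Pn[z].
    by rewrite !inE => /andP[/orP[]/eqP-> ]; rewrite ?xS ?yS.
  (* Since [x] lies in [S] and the edge [xz] is covered, [z] lies outside [S]; then [zx] and [zy]
     both have trace [{z}]. *)
  case/andP=> Gxz Gzy; have zS : z \notin S.
    apply/negP => zS; have := cS [set x; z]; rewrite edge_set2 => /(_ Gxz).
    by case/set0Pn=> t; rewrite !inE => /andP[/orP[]/eqP-> ]; rewrite ?xS ?zS.
  have := iS [set z; x]; rewrite edge_set2 adj_sym => /(_ Gxz)/forall_inP.
  move/(_ [set z; y]); rewrite edge_set2 => /(_ Gzy)/implyP nE; move: nE.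
  have -> : [set z; x] != [set z; y] by apply: contraNneq xy => /set2_injr->.
  move/(_ isT)/eqP; apply; apply/setP=> t; rewrite !inE.
  case: (t =P x) => [->|_]; first by rewrite xS !andbF.
  by case: (t =P y) => [->|_]; first by rewrite yS !andbF.
have meetS x y : G x y -> (x \notin S) || (y \notin S).
  move=> Gxy; rewrite -negb_and; apply/negP => /andP[xS yS].
  by have [] := pS x y xS yS (adj_neq Gxy); rewrite Gxy.
split; apply/forall_inP => e /edgesP[x [y [Gxy ->]]] {e}.
  by apply/set0Pn; case/orP: (meetS x y Gxy) => ?; [exists x|exists y];
    rewrite !inE eqxx ?orbT.
apply/forall_inP => f Gf; apply/implyP; apply: contraNneq => Exy.
wlog xS : x y Gxy Exy / x \notin S.
  move=> W; case/orP: (meetS x y Gxy) => [/(W x y)|/(W y x)]; first exact.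
  by rewrite setUC adj_sym; apply.
have : x \in f by have: x \in f :&: ~: S; [rewrite -Exy !inE eqxx | case/setIP].
have [z [Gxz Ef]] : exists z, G x z /\ (x \in f -> f = [set x; z]).
  case/edgesP: Gf Exy => a [b [Gab ->]] Exy.
  have /setIP[/set2P[] xE _] : x \in [set a; b] :&: ~: S.
  - by rewrite -Exy !inE eqxx.
  - by exists b; rewrite xE.
  - by exists a; rewrite xE setUC adj_sym.
(* If [y] and [z] differ, equality of the traces forces both into [S], where their common neighbour
   [x] contradicts the packing property. *)
move/Ef => fE; rewrite fE in Exy *; have [-> //|yz] := eqVneq y z.
have yS : y \in S.
  apply/negPn/negP => yS.
  have: y \in [set x; z] :&: ~: S by rewrite -Exy !inE eqxx orbT yS.
  by rewrite !inE (negPf yz) orbF => /andP[/eqP yx]; rewrite yx adj_irr in Gxy.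
have zS : z \in S.
  apply/negPn/negP => zS.
  have: z \in [set x; y] :&: ~: S by rewrite Exy !inE eqxx orbT zS.
  rewrite !inE [z == y]eq_sym (negPf yz) orbF => /andP[/eqP zx].
  by rewrite zx adj_irr in Gxz.
by have [_ /(_ x)] := pS y z yS zS yz; rewrite adj_sym Gxy Gxz.
Qed.

Lemma leq_rho S : packing G S -> #|S| <= rho G.
Proof. by move=> pS; rewrite /rho (bigop.bigmax_sup S). Qed.

(** Complementation exchanges identifying vertex covers and packings, so minimum covers correspond
    to maximum packings. *)
Lemma tau_D_rho : tau_D G = nverts G - rho G.
Proof.
have ivcT : identifying_vertex_cover G [set: V] by apply: setT_identifying.
rewrite /tau_D; case: (arg_minnP (fun S : {set V} => #|S|) ivcT) => S ivcS minS.
have cardS (A : {set V}) : #|~: A| = nverts G - #|A| by rewrite /nverts [LHS]cardsCs setCK.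
apply/eqP; rewrite eqn_leq; apply/andP; split.
  (* The maximum is attained as soon as some packing exists; the complement of the full vertex set
     is one. *)
  have /(bigop.eq_bigmax_cond (fun A : {set V} => #|A|))[A pA rhoE] :
      0 < #|packing G|.
    apply/card_gt0P; exists (~: [set: V]).
    by rewrite -[_ \in _]/(packing G _) -identifying_setC setCK.
  have -> : rho G = #|A| by exact: rhoE.
  by rewrite -cardS minS // identifying_setC.
rewrite -[S]setCK cardS leq_sub2l // leq_rho //.
by rewrite -identifying_setC setCK.
Qed.

End Graphs.

(** * Bridges and the edge count of a tree *)

Section Trees.
Variables (V : finType) (T : sgraph V).
Implicit Types (x y v w : V).
Local Open Scope nat_scope.

(** A path from [x] to [y] avoiding the edge [xy], made free of repetitions, would be closed into a
    cycle by that edge. *)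
Lemma acyclic_bridge x y : acyclic T -> T x y ->
  ~~ connect [rel a b | T a b && ([set a; b] != [set x; y])] x y.
Proof.
move=> acT Txy; apply/negP => /connectP[s0 Ps0 sy0].
case/shortenP: Ps0 sy0 => s Ps Us _ sy.
apply: (acT (x :: s)); last first.
  rewrite /ucycle Us andbT /= rcons_path -sy [T y x]adj_sym Txy andbT.
  by apply: sub_path Ps => a b /andP[].
(* The cycle has at least three vertices: no step would give [x = y], and a single step would be the
   deleted edge. *)
case: s Ps Us sy => [|a [|b s]] //=.
  by move=> _ _ yx; rewrite yx adj_irr in Txy.
by rewrite andbT => /andP[_ /eqP Ns] _ ay; case: Ns; rewrite ay.
Qed.

(* In a rooted tree the edges are exactly the pairs {v, parent of v}, where the
   parent is one step closer to the root. *)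
Lemma tree_nedges : is_tree T -> nedges T = (nverts T).-1.
Proof.
case=> -[V_gt0 cT] acT; have [root _] := card_gt0P V_gt0.
have walk_root v : exists n, walk T n v root.
  by have /connectP[s Ts sr] := cT v root; exists (size s); apply/walkP; exists s.
pose depth v := ex_minn (walk_root v).
(* The parent is the second vertex of a shortest walk to the root. The guard sits under the
   existential so that [par] becomes a total function, with an arbitrary value at the root. *)
have parP v : exists w, v != root -> T v w && (depth w < depth v).
  have [->|vr] := eqVneq v root; first by exists root.
  rewrite /depth; case: (ex_minnP (walk_root v)) => n.
  case/walkP=> -[|w s] /= [Ts sr sz] _; first by rewrite sr eqxx in vr.
  case/andP: Ts => Tvw Ts; exists w => _; rewrite Tvw /=.
  case: ex_minnP => m _; rewrite -sz ltnS; apply.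
  by apply/walkP; exists s.
have /fin_all_exists[par parE] := parP.
suff ->: nedges T = #|[set [set v; par v] | v in [set~ root]]|.
  rewrite card_in_imset ?cardsC1 // => v w; rewrite !inE => vr wr Evw.
  have /andP[_ dv] := parE v vr; have /andP[_ dw] := parE w wr.
  (* Otherwise [v] and [w] would be each other's parent, and each depth would be smaller than the
     other. *)
  have /set2P[//|vE] : v \in [set w; par w] by rewrite -Evw set21.
  have /set2P[//|wE] : w \in [set v; par v] by rewrite Evw set21.
  by move: dv dw; rewrite -vE -wE => /ltn_trans lt /lt; rewrite ltnn.
apply: eq_card => e; apply/edgesP/imsetP; last first.
  case=> v; rewrite !inE => /parE/andP[Tv _] ->; by exists v, (par v).
case=> x [y [Txy ->]].
(* If [xy] were no parent edge, deleting it would keep all parent edges, so [x] and [y] would remain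
   joined through the root. *)
apply/imsetP/negPn/negP => Nxy; case/negP: (acyclic_bridge acT Txy).
set H := [rel a b | _].
have symH : connect_sym H.
  by apply: sym_connect_sym => a b; rewrite /= adj_sym setUC.
have toroot n v : depth v < n -> connect H v root.
  elim: n v => // n IHn v; rewrite ltnS => dv.
  have [->|vr] := eqVneq v root; first exact: connect0.
  have /andP[Tv lt] := parE v vr.
  apply: connect_trans (IHn (par v) (leq_trans lt dv)).
  apply: connect1; rewrite /= Tv; apply: contraNneq Nxy => <-.
  by apply/imsetP; exists v; rewrite // !inE.
apply: (connect_trans (toroot _ _ (ltnSn _))).
by rewrite symH (toroot _ _ (ltnSn _)).
Qed.

End Trees.

(** * Connectedness, degrees, edge count and packing number of the loaded tree *)

Section LoadedTree.
Variables (k : nat) (T : sgraph 'I_k) (V : finType) (R : sgraph V).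
Variable p : 'I_k -> {set 'I_k} -> V.
Local Notation G := (loaded_tree T R p).
Implicit Types (i j : 'I_k) (a b v : V).
Local Open Scope nat_scope.

Lemma loaded_tree_nverts : nverts G = nverts R * k.
Proof. by rewrite /nverts card_prod card_ord mulnC. Qed.

Lemma loaded_tree_adj_copy i a b : G (i, a) (i, b) = R a b.
Proof. by rewrite /= /loaded_tree_adj /= eqxx adj_irr orbF. Qed.

Lemma loaded_tree_connected : connected R -> connected T -> connected G.
Proof.
move=> [R_gt0 cR] [T_gt0 cT]; split.
  by rewrite loaded_tree_nverts muln_gt0 R_gt0 -(card_ord k).
have cG i a b : connect G (i, a) (i, b).
  have /connectP[s Rs ->] := cR a b; apply/connectP; exists [seq (i, v) | v <- s].
    rewrite path_map; apply: sub_path Rs => x y Rxy.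
    by rewrite /= /loaded_tree_adj /= eqxx Rxy.
  by rewrite last_map.
move=> [i a] [j b]; have /connectP[s Ts ->] := cT i j.
elim: s i a Ts => [|l s IHs] i a /=; first by move=> _; apply: cG.
case/andP=> Til /(IHs _ (p l [set i; l])); apply: connect_trans.
(* Move inside copy [i] to the port of the edge [il], then cross that edge. *)
apply: connect_trans (cG i a (p i [set i; l])) (connect1 _).
by rewrite /= /loaded_tree_adj /= Til !eqxx orbT.
Qed.

(** The neighbours of [(i, v)] outside its copy correspond to the edges of [T] at [i] with port [v];
    they are disjoint from those inside because [T] has no loops. *)
Lemma loaded_tree_deg i v : deg G (i, v) = deg R v + load T p i v.
Proof.
pose far := [set (j, p j [set i; j]) | j in [set j | T i j && (p i [set i; j] == v)]].
have -> : load T p i v = #|far|.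
  rewrite card_imset; last by move=> j l [].
  exact: (edges_incident T i (fun e => p i e == v)).
have -> : deg R v = #|[set (i, w) | w in [set w | R v w]]|.
  by rewrite card_imset // => a b; case.
rewrite -cardsUI [X in _ = _ + X](_ : _ = 0) ?addn0; last first.
  apply: eq_card0 => -[j b]; rewrite inE; apply/negP => /andP[].
  case/imsetP=> w _ [-> _] /imsetP[l]; rewrite inE => /andP[Til _] [il _].
  by rewrite -il adj_irr in Til.
apply: eq_card => -[j b]; rewrite !inE /= /loaded_tree_adj /=; apply/orP/orP.
  case=> [/andP[/eqP<- Rvb]|/and3P[Tij /eqP vE /eqP bE]]; [left|right].
    by apply/imsetP; exists b; rewrite ?inE.
  by apply/imsetP; exists j; rewrite ?inE ?Tij -?vE -?bE ?eqxx.
case=> /imsetP[w]; rewrite inE => Hw [-> ->]; [left|right].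
  by rewrite eqxx.
by case/andP: Hw => -> /eqP->; rewrite !eqxx.
Qed.

Lemma loaded_tree_max_deg r : regular R r -> connected R -> 0 < k ->
  max_deg G = r + max_load T p.
Proof.
move=> regR [V_gt0 _] k_gt0.
have [v0 _] := card_gt0P V_gt0.
apply/eqP; rewrite eqn_leq; apply/andP; split.
  apply/bigmax_leqP => -[i v] _; rewrite loaded_tree_deg regR leq_add2l.
  by rewrite /max_load (bigop.bigmax_sup i) // (bigop.bigmax_sup v).
(* Both nested maxima are attained because [k] is positive and [R] is nonempty; by regularity, a
   vertex of maximum load has maximum degree. *)
have [i Ei] : {i : 'I_k | max_load T p = \max_v load T p i v}.
  by apply: bigop.eq_bigmax; rewrite card_ord.
have [v Ev] := bigop.eq_bigmax (load T p i) V_gt0.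
by rewrite Ei Ev -(regR v) -loaded_tree_deg /max_deg (bigop.bigmax_sup (i, v)).
Qed.

(** Each edge of [T] at [i] has exactly one port in copy [i], so the ports partition these edges. *)
Lemma sum_load i : \sum_v load T p i v = deg T i.
Proof.
rewrite deg_edges -sum1dep_card (partition_big (p i) predT) //=.
apply: eq_bigr => v _; rewrite sum1dep_card; apply: eq_card => e.
by rewrite !inE andbA.
Qed.

(** Handshake in both [G] and [T]: every vertex of [G] contributes [r] plus its load. Keeping the
    factor two avoids halving in [nat]. *)
Lemma loaded_tree_nedges r : regular R r ->
  2 * nedges G = r * nverts R * k + 2 * nedges T.
Proof.
move=> regR; rewrite -2!handshake -mulnA -loaded_tree_nverts mulnC -sum_nat_const.
under [X in _ = _ + X]eq_bigr => i _ do rewrite -sum_load.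
rewrite [X in _ = _ + X]pair_big -big_split /=.
by apply: eq_bigr => -[i v] _; rewrite loaded_tree_deg regR.
Qed.

Lemma loaded_tree_rho : diam_le R 2 ->
  (forall i, exists s, load T p i s = 0) -> rho G = k.
Proof.
move=> diamR /fin_all_exists[s s0]; apply/eqP; rewrite eqn_leq; apply/andP; split.
  apply/bigmax_leqP => S /packingP pS; rewrite -[k in _ <= k]card_ord.
  (* Two members in the same copy would be adjacent or share a neighbour there, by the diameter
     bound. *)
  rewrite -(card_in_imset (f := fst)) ?max_card // => -[i a] [j b] aS bS /= ij.
  rewrite -{}ij in bS *; congr (_, _); apply/eqP/negPn/negP => ab.
  have := diamR a b; rewrite dist_le2 (negPf ab) /=.
  have [|nG ncG] := pS _ _ aS bS; first by rewrite xpair_eqE eqxx.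
  rewrite loaded_tree_adj_copy in nG; rewrite (negPf nG) /=.
  case/existsP=> c; have := ncG (i, c).
  by rewrite !loaded_tree_adj_copy => /negPf->.
(* An edge leaving the copy at [s i] would come from an edge of [T] counted in the load of [s i],
   which is zero. *)
have sG i y : G (i, s i) y -> y.1 = i.
  case: y => j b /=; rewrite /loaded_tree_adj /=.
  case/orP=> [/andP[/eqP]|/and3P[Tij /eqP sE _]] //.
  have /eqP := s0 i; rewrite cards_eq0 => /eqP/setP/(_ [set i; j]).
  by rewrite inE edge_set2 Tij set21 -sE eqxx in_set0.
have sinj : injective (fun i => (i, s i)) by move=> i j [].
rewrite -[k in k <= _]card_ord -(card_imset predT sinj) leq_rho //.
apply/packingP => _ _ /imsetP[i _ ->] /imsetP[j _ ->] ij.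
split=> [|z]; apply/negP.
  by move/sG => /= ji; rewrite ji eqxx in ij.
(* A common neighbour of two selectors would lie in both of their copies. *)
by case/andP=> /sG zi; rewrite adj_sym => /sG zj; rewrite -zi -zj eqxx in ij.
Qed.

End LoadedTree.

Theorem theorem4p2 (V : finType) (R : sgraph V) (r q : nat)
    (k : nat) (T : sgraph 'I_k) (p : 'I_k -> {set 'I_k} -> V) (L : nat)
    (R_conn : connected R) (R_reg : regular R r) (R_order : nverts R = q)
    (R_diam : diam_le R 2)
    (k_ge2 : (2 <= k)%N) (T_tree : is_tree T)
    (p_load : max_load T p = L)
    (p_selector : forall i : 'I_k, exists s : V, load T p i s = 0%N) :
  let G := loaded_tree T R p in
  [/\ connected G,
      nverts G = (q * k)%N,
      (nedges G)%:R = r%:R * q%:R * k%:R / 2 + k%:R - 1 :> rat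
    & max_deg G = (r + L)%N] /\
  [/\ rho G = k,
      tau_D G = ((q - 1) * k)%N,
      mu G = k%:Z * ((r%:Z + L%:Z) ^+ 2 + 3 - (L%:Z + 1) * q%:Z) - 2
    & (tau_D G)%:R - B_HY G =
        (k%:R * ((L%:R + 1) * q%:R - (r%:R + L%:R) ^+ 2 - 3) + 2) /
        ((r%:R + L%:R) ^+ 2 + 1)].
Proof.
move=> G.
have k_gt0 : (0 < k)%N by apply: leq_trans k_ge2.
have q_gt0 : (0 < q)%N by rewrite -R_order; case: R_conn.
have nG : nverts G = (q * k)%N by rewrite loaded_tree_nverts R_order.
have mT : nedges T = k.-1 by rewrite (tree_nedges T_tree) /nverts card_ord.
have mG : (2 * nedges G = r * q * k + 2 * k.-1)%N.
  by rewrite (loaded_tree_nedges _ _ R_reg) R_order mT.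
have DG : max_deg G = (r + L)%N by rewrite (loaded_tree_max_deg _ _ R_reg) ?p_load.
have rhoG : rho G = k by apply: loaded_tree_rho.
have tG : tau_D G = ((q - 1) * k)%N.
  by rewrite tau_D_rho nG rhoG mulnBl mul1n.
(* Stated over any ring, to serve [mu] in [int] as well as [B_HY] in [rat]; positivity of [k] turns
   the predecessor into a true subtraction. *)
have mGR (A : pzRingType) : 2 * (nedges G)%:R = r%:R * q%:R * k%:R + 2 * (k%:R - 1) :> A.
  have -> : k%:R - 1 = k.-1%:R :> A by rewrite -subn1 natrB.
  by rewrite -!natrM -natrD mG.
have tGR (A : pzRingType) : (tau_D G)%:R = (q%:R - 1) * k%:R :> A.
  by rewrite tG natrM natrB.
split; split=> //.
- exact: loaded_tree_connected R_conn T_tree.1.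
- by apply: (mulfI (x := 2)) => //; rewrite mGR; field.
- have mZ := mGR int; have tZ := tGR int; rewrite !natz in mZ tZ.
  by rewrite /mu mZ tZ nG DG PoszM PoszD; ring.
- have D_neq0 : (r%:R + L%:R) ^+ 2 + 1 != 0 :> rat.
    by rewrite gt_eqF // ltr_wpDl ?sqr_ge0.
  by rewrite /B_HY mGR tGR nG DG natrM natrD; field.
Qed.
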